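(* Let $\Bbbk$ be a field of characteristic zero and let $\mathcal{O}=\mathcal{P}(E,R)=\mathcal{F}(E)/(R)$ be a quadratic Koszul graded operad over $\Bbbk$, with $E$ a reduced graded $\mathbb{S}$-module. Let $A$ be a DG-$\mathcal{O}$-algebra and let $\phi\in C_{\mathcal{O}}^{2,-1}(H_*(A),H_*(A))$ be a cocycle representing Dimitrova's class $\{m\}\in H_{\mathcal{O}}^{2,-1}(H_*(A),H_*(A))$. Let $\Gamma=\sum(\mu^{(1)}\circ_l\mu^{(2)})\cdot\sigma\in R(r)$ be a relation and let $x_1,\dots,x_r\in H_*(A)$ be homogeneous elements such that $\mu^{(2)}(x_{\sigma^{-1}(l)},\dots,x_{\sigma^{-1}(l+r_2-1)})=0$ in $H_*(A)$ for each summand of $\Gamma$. Then $$\phi(s^2\Gamma;x_1,\dots,x_r)\in\langle x_1,\dots,x_r\rangle_\Gamma,$$ where the Massey product $\langle x_1,\dots,x_r\rangle_\Gamma$ is regarded as a coset in $H_{|\Gamma|+\sum_{i=1}^r|x_i|+1}(A)$.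
   Context: **General conventions.** Operads are symmetric operads in graded $\Bbbk$-vector spaces with homological grading; $|x|$ is the degree of $x$. $\mathcal{F}(E)$ is the free operad on $E$ and $R\subset\mathcal{F}(E)^{(2)}$ is a sub-$\mathbb{S}$-module of the weight $2$ part. In $\Gamma=\sum(\mu^{(1)}\circ_l\mu^{(2)})\cdot\sigma$ all symbols depend on the summand: $\mu^{(1)}\in E(r_1)$, $\mu^{(2)}\in E(r_2)$ homogeneous, $r_1+r_2-1=r$, $1\le l\le r_1$, $\sigma\in\mathbb{S}_r$, and $|\mu^{(1)}|+|\mu^{(2)}|=|\Gamma|$. On algebras, $(\mu\cdot\sigma)(x_1,\dots,x_r)=(-1)^{\alpha}\mu(x_{\sigma^{-1}(1)},\dots,x_{\sigma^{-1}(r)})$ with $\alpha=\sum_{s<t,\,\sigma(s)>\sigma(t)}|x_s||x_t|$. Write $\gamma=\alpha+|\mu^{(1)}|+(|\mu^{(2)}|-1)\sum_{m=1}^{l-1}|x_{\sigma^{-1}(m)}|$. **Massey product.** Choose cycles $y_i$ representing $x_i$ and, for each summand of $\Gamma$, $\rho^{(2)}\in A$ with $d(\rho^{(2)})=\mu^{(2)}(y_{\sigma^{-1}(l)},\dots,y_{\sigma^{-1}(l+r_2-1)})$. Then $\langle x_1,\dots,x_r\rangle_\Gamma$ is the coset in $H_{|\Gamma|+\sum|x_i|+1}(A)$ of the homology class of $$\sum(-1)^{\gamma}\mu^{(1)}(y_{\sigma^{-1}(1)},\dots,y_{\sigma^{-1}(l-1)},\rho^{(2)},y_{\sigma^{-1}(l+r_2)},\dots,y_{\sigma^{-1}(r)})$$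 modulo the indeterminacy $$\sum\mu^{(1)}\bigl(x_{\sigma^{-1}(1)},\dots,x_{\sigma^{-1}(l-1)},H_{|\mu^{(2)}|+\sum_{i=1}^{r_2}|x_{\sigma^{-1}(l+i-1)}|+1}(A),x_{\sigma^{-1}(l+r_2)},\dots,x_{\sigma^{-1}(r)}\bigr)$$ (sum of subspaces over the summands of $\Gamma$). This coset is independent of choices. **Koszul dual cooperad.** $\mathcal{O}^{¡}$ is the Koszul dual coaugmented cooperad, cogenerated by $sE$ with corelations $s^2R$ ($s$ = suspension); in low weights $(\mathcal{O}^{¡})^{(0)}=\mathbb{I}$ (the unit $\mathbb{S}$-module, $\Bbbk$ in arity 1 and degree 0, with generator $1$), $(\mathcal{O}^{¡})^{(1)}=sE$, $(\mathcal{O}^{¡})^{(2)}=s^2R$. Its infinitesimal decomposition is written $\Delta_{(1)}(\mu)=\sum_{(\mu)}(\mu^{(1)}\circ_l\mu^{(2)})\cdot\sigma$ and its full decomposition $\Delta(\mu)=\sum_{[\mu]}(\nu;\nu^1,\dots,\nu^l)\cdot\tau$. For $\Gamma=\sum(\mu^{(1)}\circ_l\mu^{(2)})\cdot\sigma\in R(r)$, with $\mu^{(1)}\in E(r_1)$, $\mu^{(2)}\in E(r_2)$, $r_1+r_2-1=r$, $1\le l\le r_1$ and $\sigma\in\mathbb{S}_r$ in each summand, $$\Delta_{(1)}(s^2\Gamma)=1\circ_1(s^2\Gamma)+\sum_{i=1}^r(s^2\Gamma)\circ_i1+\sum(-1)^{|\mu^{(1)}|}(s\mu^{(1)}\circ_l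 s\mu^{(2)})\cdot\sigma,$$ and, correspondingly, the part of $\Delta(s^2\Gamma)$ other than $(1;s^2\Gamma)+(s^2\Gamma;1,\dots,1)$ is $\sum(-1)^{|\mu^{(1)}|}(s\mu^{(1)};1,\dots,1,s\mu^{(2)},1,\dots,1)\cdot\sigma$ with $s\mu^{(2)}$ in slot $l$. The canonical twisting morphism $\kappa\colon\mathcal{O}^{¡}\to\mathcal{O}$ has degree $-1$, $\kappa(s\mu)=\mu$ for $\mu\in E$, and vanishes in weights $\ne1$. **$\mathcal{O}_\infty$-algebras.** An $\mathcal{O}_\infty$-algebra structure on a complex $A$ consists of maps $\mathcal{O}^{¡}(r)_n\otimes A_{p_1}\otimes\cdots\otimes A_{p_r}\to A_{n+\sum p_i-1}$, $\mu\otimes x_1\otimes\cdots\otimes x_r\mapsto\mu(x_1,\dots,x_r)$, with $(\mu\cdot\sigma)(x_1,\dots,x_r)=(-1)^\alpha\mu(x_{\sigma^{-1}(1)},\dots,x_{\sigma^{-1}(r)})$, $1(x)=0$, and $$d(\mu(x_1,\dots,x_r))+\sum_{s=1}^r(-1)^{\beta}\mu(x_1,\dots,d(x_s),\dots,x_r)+\sum_{(\mu)}(-1)^{\gamma}\mu^{(1)}(x_{\sigma^{-1}(1)},\dots,\mu^{(2)}(x_{\sigma^{-1}(l)},\dots),\dots)=0,$$ where $\beta=|\mu|+\sum_{t=1}^{s-1}|x_t|$ and $\gamma=\alpha+|\mu^{(1)}|+(|\mu^{(2)}|-1)\sum_{m=1}^{l-1}|x_{\sigma^{-1}(m)}|$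 with $\alpha=\sum_{s<t,\,\sigma(s)>\sigma(t)}|x_s||x_t|$ (with $|\mu^{(i)}|$ the degree in $\mathcal{O}^{¡}$). A DG-$\mathcal{O}$-algebra is an $\mathcal{O}_\infty$-algebra by letting $\mu\in\mathcal{O}^{¡}$ act as $\kappa(\mu)$. An $\mathcal{O}_\infty$-algebra structure extends a graded $\mathcal{O}$-algebra structure if $(s\mu)(x_1,\dots,x_r)=\mu(x_1,\dots,x_r)$ for all $\mu\in E(r)$. **$\infty$-morphisms.** An $\infty$-morphism $f\colon A\leadsto B$ of $\mathcal{O}_\infty$-algebras consists of maps $\mathcal{O}^{¡}(r)_n\otimes A_{p_1}\otimes\cdots\otimes A_{p_r}\to B_{n+\sum p_i}$, $\mu\otimes x_1\otimes\cdots\otimes x_r\mapsto f(\mu)(x_1,\dots,x_r)$, with $f(\mu\cdot\sigma)(x_1,\dots,x_r)=(-1)^\alpha f(\mu)(x_{\sigma^{-1}(1)},\dots,x_{\sigma^{-1}(r)})$ and $$\sum_{(\mu)}(-1)^{\gamma}f(\mu^{(1)})(x_{\sigma^{-1}(1)},\dots,\mu^{(2)}(x_{\sigma^{-1}(l)},\dots),\dots)-\sum_{[\mu]}(-1)^{\lambda}\nu(f(\nu^1)(x_{\tau^{-1}(1)},\dots),\dots,f(\nu^l)(\dots,x_{\tau^{-1}(r)}))$$ $$=d(f(\mu)(x_1,\dots,x_r))-\sum_{t=1}^r(-1)^{\beta}f(\mu)(x_1,\dots,d(x_t),\dots,x_r),$$ where $\lambda$ is the sum of $\sum_{s<t,\,\tau(s)>\tau(t)}|x_s||x_t|$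 and of all $|\nu^u||x_{\tau^{-1}(v)}|$ such that $\nu^u$ appears after $x_{\tau^{-1}(v)}$. It is an $\infty$-quasi-isomorphism if the chain map $f(1)$ is a quasi-isomorphism. **Minimal model.** A minimal model of a DG-$\mathcal{O}$-algebra $A$ is an $\mathcal{O}_\infty$-algebra structure on $H_*(A)$ (with zero differential) extending the induced graded $\mathcal{O}$-algebra structure, together with an $\infty$-quasi-isomorphism $f\colon H_*(A)\leadsto A$ whose underlying chain map $f(1)$ sends each homology class to a representing cycle. **Operadic cohomology.** For a graded $\mathcal{O}$-algebra $B$ and a $B$-module $M$, $C_{\mathcal{O}}^{w,t}(B,M)=\operatorname{Hom}_{-t-w}((\mathcal{O}^{¡})^{(w)}\circ B,M)$ (maps of degree $-t-w$, where $(\mathcal{O}^{¡})^{(w)}\circ B=\bigoplus_r(\mathcal{O}^{¡})^{(w)}(r)\otimes_{\mathbb{S}_r}B^{\otimes r}$), with differential $d\colon C_{\mathcal{O}}^{w,t}\to C_{\mathcal{O}}^{w+1,t}$, $$d(g)(\mu;x_1,\dots,x_r)=\sum_{(\mu)}(-1)^{\gamma'}\kappa(\mu^{(1)})(x_{\sigma^{-1}(1)},\dots,g(\mu^{(2)};x_{\sigma^{-1}(l)},\dots),\dots)-\sum_{(\mu)}(-1)^{\gamma+|g|}g(\mu^{(1)};x_{\sigma^{-1}(1)},\dots,\kappa(\mu^{(2)})(x_{\sigma^{-1}(l)},\dots),\dots),$$ where $|g|=w+t$ and $\gamma'=\alpha+|\mu^{(1)}||g|+(|\mu^{(2)}|+|g|)\sum_{m=1}^{l-1}|x_{\sigma^{-1}(m)}|$.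 Its cohomology is $H_{\mathcal{O}}^{\star,*}(B,M)$. **Dimitrova's class.** Given a minimal model $H_*(A)\leadsto A$, Dimitrova's class $\{m\}\in H_{\mathcal{O}}^{2,-1}(H_*(A),H_*(A))$ is the class of the cocycle $m\in C_{\mathcal{O}}^{2,-1}(H_*(A),H_*(A))$ defined by $m(s^2\Gamma;x_1,\dots,x_r)=(s^2\Gamma)(x_1,\dots,x_r)$ for $\Gamma\in R(r)$, $x_i\in H_*(A)$, using $(\mathcal{O}^{¡})^{(2)}=s^2R$. Thus $\phi$ represents the class when $\phi-m$ is a coboundary.
   Formalization: The sign of s²Γ is corrected: its decomposition has cross terms with sign (-1)^{|μ^{(1)}|+1} instead of (-1)^{|μ^{(1)}|}; with the literal sign the Massey product contains -φ(s²Γ;x_1,…,x_r), and the claim fails for Λ(a,b,c), dc=ab. *)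

(* Defs.v *)
From Stdlib Require List.
From mathcomp Require Import all_boot all_order all_fingroup all_algebra.

Set Implicit Arguments.
Unset Strict Implicit.
Unset Printing Implicit Defensive.

Import Order.TTheory GRing.Theory Num.Theory.
Local Open Scope ring_scope.

(* A graded vector space is given by its total space, the internal direct sum
   of the subspaces [deg n]. *)
Record gmod (k : fieldType) := GMod {
  gcarrier :> lmodType k;
  deg : int -> gcarrier -> Prop;
  deg_zero : forall n, deg n 0;
  deg_lin : forall n (a : k) (x y : gcarrier),
    deg n x -> deg n y -> deg n (a *: x + y);
  deg_span : forall x, exists (s : seq int) (c : int -> gcarrier),
    (forall n, deg n (c n)) /\ x = \sum_(n <- s) c n;
  deg_indep : forall (s : seq int) (c : int -> gcarrier), uniq s ->
    (forall n, deg n (c n)) -> \sum_(n <- s) c n = 0 ->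
    forall n, n \in s -> c n = 0 }.

(* Right actions.  The product of permutations of MathComp is the opposite of
   composition of functions: [(t * s) i = s (t i)]. *)
Record smod (k : fieldType) := SMod {
  scarrier :> nat -> gmod k;
  act : forall r, scarrier r -> 'S_r -> scarrier r;
  act_lin : forall r (s : 'S_r) (a : k) (x y : scarrier r),
    act (a *: x + y) s = a *: act x s + act y s;
  act_deg : forall r (s : 'S_r) n (x : scarrier r), deg n x -> deg n (act x s);
  act_one : forall r (x : scarrier r), act x 1%g = x;
  act_mul : forall r (x : scarrier r) (s t : 'S_r),
    act (act x s) t = act x (t * s)%g }.

Definition is_smap (k : fieldType) (e : int) (M N : smod k)
    (f : forall r, M r -> N r) : Prop :=
  [/\ forall r (a : k) (x y : M r), f r (a *: x + y) = a *: f r x + f r y,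
      forall r n (x : M r), deg n x -> deg (n + e) (f r x) &
      forall r (x : M r) (s : 'S_r), f r (act x s) = act (f r x) s].

Definition reduced (k : fieldType) (M : smod k) : Prop := forall x : M 0%N, x = 0.

Definition sg (k : fieldType) (n : int) : k := (-1) ^ n.

(* Position, among the inputs of [a o_i b] with [b] of arity [n], of the input
   [q != i] of [a] (slots and positions are numbered from 0). *)
Definition place (i n q : nat) : nat := if (q < i)%N then q else (q + n).-1.

(* Partial composition takes a proof of [m + n = r.+1] as an argument, so that
   no transport between arities is needed. *)
Record operad (k : fieldType) := Operad {
  ocarrier :> smod k;
  ounit : ocarrier 1%N;
  ocomp : forall m n r, (m + n)%N = r.+1 ->
    ocarrier m -> 'I_m -> ocarrier n -> ocarrier r;
  ounit_deg : deg 0 ounit;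
  ocomp_deg : forall m n r (e : (m + n)%N = r.+1) a i b da db,
    deg da a -> deg db b -> deg (da + db) (ocomp e a i b);
  ocomp_linl : forall m n r (e : (m + n)%N = r.+1) i b (c : k) a a',
    ocomp e (c *: a + a') i b = c *: ocomp e a i b + ocomp e a' i b;
  ocomp_linr : forall m n r (e : (m + n)%N = r.+1) a i (c : k) b b',
    ocomp e a i (c *: b + b') = c *: ocomp e a i b + ocomp e a i b';
  ocomp_unitl : forall n (e : (1 + n)%N = n.+1) i (b : ocarrier n),
    ocomp e ounit i b = b;
  ocomp_unitr : forall m (e : (m + 1)%N = m.+1) (a : ocarrier m) i,
    ocomp e a i ounit = a;
  ocomp_seq : forall l m n u v r (e1 : (l + m)%N = u.+1) (e2 : (u + n)%N = r.+1)
      (e3 : (m + n)%N = v.+1) (e4 : (l + v)%N = r.+1) a (i : 'I_l) b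
      (j : 'I_m) c (q : 'I_u),
    q = (i + j)%N :> nat ->
    ocomp e2 (ocomp e1 a i b) q c = ocomp e4 a i (ocomp e3 b j c);
  ocomp_par : forall l m n u v r (e1 : (l + m)%N = u.+1) (e2 : (u + n)%N = r.+1)
      (e3 : (l + n)%N = v.+1) (e4 : (v + m)%N = r.+1) a (i j : 'I_l) b c
      (q : 'I_u) (q' : 'I_v) db dc,
    (i < j)%N -> q = place i m j :> nat -> q' = i :> nat ->
    deg db b -> deg dc c ->
    ocomp e2 (ocomp e1 a i b) q c =
    sg k (db * dc) *: ocomp e4 (ocomp e3 a j c) q' b;
  ocomp_actl : forall m n r (e : (m + n)%N = r.+1) a (i : 'I_m) b (s : 'S_m) (s' : 'S_r),
    (forall (j : 'I_n) (p : 'I_r), p = (i + j)%N :> nat ->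
       s' p = (s i + j)%N :> nat) ->
    (forall (q : 'I_m) (p : 'I_r), q != i -> p = place i n q :> nat ->
       s' p = place (s i) n (s q) :> nat) ->
    ocomp e (act a s) i b = act (ocomp e a (s i) b) s';
  ocomp_actr : forall m n r (e : (m + n)%N = r.+1) a (i : 'I_m) b (s : 'S_n) (s' : 'S_r),
    (forall (j : 'I_n) (p : 'I_r), p = (i + j)%N :> nat ->
       s' p = (i + s j)%N :> nat) ->
    (forall (q : 'I_m) (p : 'I_r), q != i -> p = place i n q :> nat ->
       s' p = p) ->
    ocomp e a i (act b s) = act (ocomp e a i b) s' }.

Definition operad_morphism (k : fieldType) (P Q : operad k)
    (f : forall r, P r -> Q r) : Prop :=
  [/\ is_smap 0 f, f 1%N (ounit P) = ounit Q &
      forall m n r (e : (m + n)%N = r.+1) a i b,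
        f r (ocomp e a i b) = ocomp e (f m a) i (f n b)].

Definition is_free_operad (k : fieldType) (E : smod k) (F : operad k)
    (eta : forall r, E r -> F r) : Prop :=
  is_smap 0 eta /\
  forall (P : operad k) (g : forall r, E r -> P r), is_smap 0 g ->
  exists h : forall r, F r -> P r,
    [/\ operad_morphism h, forall r x, h r (eta r x) = g r x &
        forall h' : forall r, F r -> P r, operad_morphism h' ->
          (forall r x, h' r (eta r x) = g r x) -> forall r x, h' r x = h r x].

Record is_operad_ideal (k : fieldType) (F : operad k)
    (I : forall r, F r -> Prop) : Prop := {
  ideal_zero : forall r, I r 0;
  ideal_lin : forall r (a : k) x y, I r x -> I r y -> I r (a *: x + y);
  ideal_act : forall r x s, I r x -> I r (act x s);
  ideal_compl : forall m n r (e : (m + n)%N = r.+1) a i b,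
    I m a -> I r (ocomp e a i b);
  ideal_compr : forall m n r (e : (m + n)%N = r.+1) a i b,
    I n b -> I r (ocomp e a i b) }.

(* [(it_top o_it_l it_bot) . it_perm]; [it_dtop] and [it_dbot] are the degrees
   of [it_top] and [it_bot]. *)
Record iterm (k : fieldType) (M N : smod k) (r : nat) := ITerm {
  it_r1 : nat; it_r2 : nat;
  it_top : M it_r1;
  it_l : 'I_it_r1;
  it_bot : N it_r2;
  it_dtop : int; it_dbot : int;
  it_perm : 'S_r }.
Arguments ITerm {k M N r} it_r1 it_r2 it_top it_l it_bot it_dtop it_dbot it_perm.

Definition it_ok (k : fieldType) (M N : smod k) r (t : iterm M N r) : Prop :=
  [/\ deg (it_dtop t) (it_top t), deg (it_dbot t) (it_bot t) &
      (it_r1 t + it_r2 t)%N = r.+1].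

(* The value in [F r] of a composite of elements of [E]; the second branch
   is not taken when [it_ok t] holds. *)
Definition it_eval (k : fieldType) (E : smod k) (F : operad k)
    (eta : forall r, E r -> F r) r (t : iterm E E r) : F r :=
  if @eqP _ (it_r1 t + it_r2 t)%N r.+1 is ReflectT e
  then act (ocomp e (eta _ (it_top t)) (it_l t) (eta _ (it_bot t))) (it_perm t)
  else 0.

Record quadratic_operad (k : fieldType) := QuadraticOperad {
  qE : smod k;
  qF : operad k;
  qeta : forall r, qE r -> qF r;
  qF_free : is_free_operad qeta;
  qR : smod k;
  qincl : forall r, qR r -> qF r;
  qincl_smap : is_smap 0 qincl;
  qincl_inj : forall r (x y : qR r), qincl x = qincl y -> x = y;
  qR_weight2 : forall r (x : qR r), exists ts : seq (iterm qE qE r),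
    List.Forall (@it_ok _ _ _ _) ts /\ qincl x = \sum_(t <- ts) it_eval qeta t;
  qO : operad k;
  qproj : forall r, qF r -> qO r;
  qproj_morph : operad_morphism qproj;
  qproj_surj : forall r (y : qO r), exists x, qproj x = y;
  qproj_ker : forall r (x : qF r), qproj x = 0 <->
    (forall I : forall r, qF r -> Prop, is_operad_ideal I ->
       (forall r' (y : qR r'), I r' (qincl y)) -> I r x) }.

Definition qgen (k : fieldType) (P : quadratic_operad k) r (x : qE P r) : qO P r :=
  qproj (qeta x).

(* [Gamma] has degree [n] and [ts] is an expression of it as a sum of
   composites [(mu1 o_l mu2) . sigma] of homogeneous generators. *)
Definition is_presentation (k : fieldType) (P : quadratic_operad k) r n
    (Gamma : qR P r) (ts : seq (iterm (qE P) (qE P) r)) : Prop :=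
  [/\ deg n Gamma,
      List.Forall (fun t => it_ok t /\ it_dtop t + it_dbot t = n) ts &
      qincl Gamma = \sum_(t <- ts) it_eval (@qeta _ P) t].

Definition subst_at (T : Type) r (x : 'I_r -> T) (i : 'I_r) (a : T) : 'I_r -> T :=
  fun j => if j == i then a else x j.

Definition permuted (T : Type) r (x : 'I_r -> T) (s : 'S_r) : 'I_r -> T :=
  fun i => x (s^-1 i)%g.

Definition plist (T : Type) r (x : 'I_r -> T) (s : 'S_r) : seq T :=
  [seq permuted x s i | i <- enum 'I_r].

Definition alpha r (s : 'S_r) (p : 'I_r -> int) : int :=
  \sum_(i < r) \sum_(j < r | (i < j)%N && (s j < s i)%N) p i * p j.

Definition homog (k : fieldType) (A : gmod k) r (p : 'I_r -> int)
    (x : 'I_r -> A) : Prop := forall i, deg (p i) (x i).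

(* Equivariant families [M(r)_n (x) A_p1 (x) ... (x) A_pr -> B_(n+p1+...+pr+e)]. *)
Record is_cmap (k : fieldType) (M : smod k) (A B : gmod k) (e : int)
    (f : forall r, M r -> ('I_r -> A) -> B) : Prop := {
  cmap_linl : forall r (a : k) (mu nu : M r) x,
    f r (a *: mu + nu) x = a *: f r mu x + f r nu x;
  cmap_linr : forall r (mu : M r) x i (a : k) u v,
    f r mu (subst_at x i (a *: u + v)) =
    a *: f r mu (subst_at x i u) + f r mu (subst_at x i v);
  cmap_deg : forall r n (mu : M r) p x, deg n mu -> homog p x ->
    deg (n + \sum_(i < r) p i + e) (f r mu x);
  cmap_act : forall r (mu : M r) (s : 'S_r) p x, homog p x ->
    f r (act mu s) x = sg k (alpha s p) *: f r mu (permuted x s) }.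

(* Inputs of the two vertices of [t] when [x] is fed to it, [v] being the
   value of the lower vertex. *)
Definition it_inner (k : fieldType) (M N : smod k) r (t : iterm M N r) (T : Type)
    (d : T) (x : 'I_r -> T) : 'I_(it_r2 t) -> T :=
  fun j => nth d (plist x (it_perm t)) (it_l t + j)%N.

Definition it_outer (k : fieldType) (M N : smod k) r (t : iterm M N r) (T : Type)
    (d : T) (x : 'I_r -> T) (v : T) : 'I_(it_r1 t) -> T :=
  let z := plist x (it_perm t) in
  fun i => nth d (take (it_l t) z ++ v :: drop (it_l t + it_r2 t)%N z) i.

Arguments it_inner {k M N r} t {T} d x.
Arguments it_outer {k M N r} t {T} d x v.

(* The Koszul sign exponent for an operation of degree [e] acting through the
   lower vertex; [e = -1] is the exponent gamma, up to parity. *)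
Definition gamma (k : fieldType) (M N : smod k) r (e : int) (t : iterm M N r)
    (p : 'I_r -> int) : int :=
  alpha (it_perm t) p + it_dtop t * e +
  (it_dbot t + e) * \sum_(d <- take (it_l t) (plist p (it_perm t))) d.

Definition infsum (k : fieldType) (M N : smod k) (A D : gmod k) (e : int)
    (psi : forall r, M r -> ('I_r -> A) -> D)
    (phi : forall r, N r -> ('I_r -> A) -> A)
    r (ts : seq (iterm M N r)) (p : 'I_r -> int) (x : 'I_r -> A) : D :=
  \sum_(t <- ts) sg k (gamma e t p) *:
    psi _ (it_top t)
      (it_outer t 0 x (phi _ (it_bot t) (it_inner t 0 x))).

(* Equality of formal sums in the infinitesimal composite: linear forms on it
   are detected by evaluation on operations.  Taking [A = X (+) Y] with [phi]
   from [X] to [Y] shows that a single space [A] is enough. *)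
Definition iteq (k : fieldType) (M N : smod k) r (ts ts' : seq (iterm M N r)) : Prop :=
  forall (A D : gmod k) (e e' : int) phi psi,
    @is_cmap k N A A e phi -> @is_cmap k M A D e' psi ->
    forall p x, homog p x -> infsum e psi phi ts p x = infsum e psi phi ts' p x.

(* [(ct_top; ct_bot 0, ..., ct_bot (ct_l - 1)) . ct_perm]; the fields
   [ct_dtop] and [ct_dbot] are degrees. *)
Record cterm (k : fieldType) (M N : smod k) (r : nat) := CTerm {
  ct_l : nat;
  ct_top : M ct_l;
  ct_ar : 'I_ct_l -> nat;
  ct_bot : forall u, N (ct_ar u);
  ct_dtop : int;
  ct_dbot : 'I_ct_l -> int;
  ct_perm : 'S_r }.
Arguments CTerm {k M N r} ct_l ct_top ct_ar ct_bot ct_dtop ct_dbot ct_perm.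
Arguments ct_ar {k M N r} t u : rename.
Arguments ct_bot {k M N r} t u : rename.
Arguments ct_dbot {k M N r} t u : rename.

Definition ct_ok (k : fieldType) (M N : smod k) r (t : cterm M N r) : Prop :=
  [/\ deg (ct_dtop t) (ct_top t), forall u, deg (ct_dbot t u) (ct_bot t u) &
      (\sum_(u < ct_l t) ct_ar t u)%N = r].

Definition ct_offset (k : fieldType) (M N : smod k) r (t : cterm M N r)
    (u : 'I_(ct_l t)) : nat :=
  (\sum_(v < ct_l t | (v < u)%N) ct_ar t v)%N.

Arguments ct_offset {k M N r} t u.

Definition ct_block (k : fieldType) (M N : smod k) r (t : cterm M N r) (T : Type)
    (d : T) (x : 'I_r -> T) (u : 'I_(ct_l t)) : 'I_(ct_ar t u) -> T :=
  fun j => nth d (plist x (ct_perm t)) (ct_offset t u + j)%N.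

Arguments ct_block {k M N r} t {T} d x u.

Definition lambda (k : fieldType) (M N : smod k) r (t : cterm M N r)
    (p : 'I_r -> int) : int :=
  alpha (ct_perm t) p +
  \sum_(u < ct_l t)
    ct_dbot t u * \sum_(d <- take (ct_offset t u) (plist p (ct_perm t))) d.

Definition fullsum (k : fieldType) (M N : smod k) (A B D : gmod k)
    (psi : forall r, M r -> ('I_r -> B) -> D)
    (phi : forall r, N r -> ('I_r -> A) -> B)
    r (ts : seq (cterm M N r)) (p : 'I_r -> int) (x : 'I_r -> A) : D :=
  \sum_(t <- ts) sg k (lambda t p) *:
    psi _ (ct_top t) (fun u => phi _ (ct_bot t u) (ct_block t 0 x u)).

(* Equality of formal sums in the composite [M o N]: the universal choice is
   [A] free on [r] elements, [B = N o A] and [D = M o B]. *)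
Definition cteq (k : fieldType) (M N : smod k) r (ts ts' : seq (cterm M N r)) : Prop :=
  forall (A B D : gmod k) (e : int) phi psi,
    @is_cmap k N A B 0 phi -> @is_cmap k M B D e psi ->
    forall p x, homog p x -> fullsum psi phi ts p x = fullsum psi phi ts' p x.

Definition ct_outdeg (k : fieldType) (M N : smod k) r (t : cterm M N r)
    (p : 'I_r -> int) : 'I_(ct_l t) -> int :=
  fun u => ct_dbot t u + \sum_(j < ct_ar t u) ct_block t 0 p u j.

Arguments ct_outdeg {k M N r} t p u.

(* The identity, viewed through a counit vanishing outside of arity 1. *)
Definition coid (k : fieldType) (C : smod k) (eps : forall r, C r -> k)
    (A : gmod k) r (mu : C r) (x : 'I_r -> A) : A :=
  eps r mu *: \sum_(i < r) x i.

(* Connected weight-graded coaugmented cooperads.  [cdelta mu] is a formal sum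
   representing the full decomposition of [mu]; only its class in [C o C] is
   meaningful, and the axioms are equalities of such classes, in the sense of
   [cteq] (in [C o C o C] for coassociativity). *)
Record wcooperad (k : fieldType) := WCooperad {
  ccarrier :> smod k;
  wt : nat -> forall r, ccarrier r -> Prop;
  wt_zero : forall w r, @wt w r 0;
  wt_lin : forall w r (a : k) (x y : ccarrier r),
    wt w x -> wt w y -> wt w (a *: x + y);
  wt_act : forall w r (x : ccarrier r) s, wt w x -> wt w (act x s);
  wt_span : forall r n (x : ccarrier r), deg n x ->
    exists (N : nat) (c : nat -> ccarrier r),
      (forall w, wt w (c w) /\ deg n (c w)) /\ x = \sum_(w < N) c w;
  wt_indep : forall r (N : nat) (c : nat -> ccarrier r),
    (forall w, wt w (c w)) -> \sum_(w < N) c w = 0 ->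
    forall w, (w < N)%N -> c w = 0;
  ceps : forall r, ccarrier r -> k;
  ceps_lin : forall r (a : k) (x y : ccarrier r),
    ceps (a *: x + y) = a * ceps x + ceps y;
  ceps_arity : forall r (x : ccarrier r), r != 1%N -> ceps x = 0;
  ceps_deg : forall r n (x : ccarrier r), deg n x -> n != 0 -> ceps x = 0;
  ceps_wt : forall r w (x : ccarrier r), wt w x -> w != 0%N -> ceps x = 0;
  cone : ccarrier 1%N;
  cone_deg : deg 0 cone;
  cone_wt : wt 0 cone;
  cone_eps : ceps cone = 1;
  wt0_arity : forall r (x : ccarrier r), wt 0 x -> r != 1%N -> x = 0;
  wt0_one : forall x : ccarrier 1%N, wt 0 x -> x = ceps x *: cone;
  cdelta : forall r, ccarrier r -> seq (cterm ccarrier ccarrier r);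
  cdelta_ok : forall r n w (x : ccarrier r), deg n x -> wt w x ->
    List.Forall (fun t =>
      [/\ ct_ok t, ct_dtop t + \sum_(u < ct_l t) ct_dbot t u = n &
          exists (w0 : nat) (w1 : 'I_(ct_l t) -> nat),
            [/\ wt w0 (ct_top t), forall u, wt (w1 u) (ct_bot t u) &
                (w0 + \sum_(u < ct_l t) w1 u)%N = w]]) (cdelta x);
  cdelta_lin : forall r (a : k) (y z : ccarrier r) (A B D : gmod k) e phi psi,
    @is_cmap k ccarrier A B 0 phi -> @is_cmap k ccarrier B D e psi ->
    forall p x, homog p x ->
    fullsum psi phi (cdelta (a *: y + z)) p x =
    a *: fullsum psi phi (cdelta y) p x + fullsum psi phi (cdelta z) p x;
  cdelta_act : forall r (mu : ccarrier r) (s : 'S_r) (A B D : gmod k) e phi psi,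
    @is_cmap k ccarrier A B 0 phi -> @is_cmap k ccarrier B D e psi ->
    forall p x, homog p x ->
    fullsum psi phi (cdelta (act mu s)) p x =
    sg k (alpha s p) *: fullsum psi phi (cdelta mu) (permuted p s) (permuted x s);
  cdelta_one : cteq (cdelta cone)
    [:: CTerm 1%N cone (fun _ => 1%N) (fun _ => cone) 0 (fun _ => 0) 1%g];
  cdelta_counitl : forall r (mu : ccarrier r) (A B : gmod k) phi,
    @is_cmap k ccarrier A B 0 phi -> forall p x, homog p x ->
    fullsum (coid ceps (A := B)) phi (cdelta mu) p x = phi r mu x;
  cdelta_counitr : forall r (mu : ccarrier r) (A D : gmod k) e psi,
    @is_cmap k ccarrier A D e psi -> forall p x, homog p x ->
    fullsum psi (coid ceps (A := A)) (cdelta mu) p x = psi r mu x;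
  cdelta_coassoc : forall r (mu : ccarrier r) (A B D X : gmod k) e phi psi chi,
    @is_cmap k ccarrier A B 0 phi -> @is_cmap k ccarrier B D 0 psi ->
    @is_cmap k ccarrier D X e chi -> forall p x, homog p x ->
    \sum_(t <- cdelta mu) sg k (lambda t p) *:
      chi _ (ct_top t) (fun u => fullsum psi phi (cdelta (ct_bot t u))
        (ct_block t 0 p u) (ct_block t 0 x u)) =
    \sum_(t <- cdelta mu) sg k (lambda t p) *:
      fullsum chi psi (cdelta (ct_top t)) (ct_outdeg t p)
        (fun u => phi _ (ct_bot t u) (ct_block t 0 x u)) }.

Definition ct_map (k : fieldType) (D C : smod k) (g : forall r, D r -> C r) r
    (t : cterm D D r) : cterm C C r :=
  CTerm (ct_l t) (g _ (ct_top t)) (ct_ar t) (fun u => g _ (ct_bot t u))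
    (ct_dtop t) (ct_dbot t) (ct_perm t).

Definition cooperad_morphism (k : fieldType) (D C : wcooperad k)
    (g : forall r, D r -> C r) : Prop :=
  [/\ is_smap 0 g,
      forall w r (x : D r), wt w x -> wt w (g r x),
      forall r (x : D r), ceps (g r x) = ceps x,
      g 1%N (cone D) = cone C &
      forall r (x : D r), cteq (cdelta (g r x)) (map (ct_map g (r := r)) (cdelta x))].

(* The infinitesimal decomposition: the counit is applied to all the lower
   vertices but one, in all possible ways. *)
Definition inf_part (k : fieldType) (C : wcooperad k) r (t : cterm C C r) :
    seq (iterm C C r) :=
  [seq ITerm (ct_l t) (ct_ar t u)
      ((\prod_(v < ct_l t | v != u) ceps (ct_bot t v)) *: ct_top t) u
      (ct_bot t u) (ct_dtop t) (ct_dbot t u) (ct_perm t) | u <- enum 'I_(ct_l t)].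

Definition cdelta1 (k : fieldType) (C : wcooperad k) r (mu : C r) :
    seq (iterm C C r) :=
  flatten [seq inf_part t | t <- cdelta mu].

(* [(1; mu)] and [(mu; 1, ..., 1)], for [mu] of degree [n]. *)
Definition ct_left (k : fieldType) (C : wcooperad k) r (n : int) (mu : C r) :
    cterm C C r :=
  CTerm 1%N (cone C) (fun _ => r) (fun _ => mu) 0 (fun _ => n) 1%g.

Definition ct_right (k : fieldType) (C : wcooperad k) r (n : int) (mu : C r) :
    cterm C C r :=
  CTerm r mu (fun _ => 1%N) (fun _ => cone C) n (fun _ => 0) 1%g.

(* [1 o_1 mu] and all the [mu o_i 1], for [mu] of degree [n]. *)
Definition it_trivial (k : fieldType) (C : wcooperad k) r (n : int) (mu : C r) :
    seq (iterm C C r) :=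
  ITerm 1%N r (cone C) ord0 mu 0 n 1%g ::
  [seq ITerm r 1%N mu i (cone C) n 0 1%g | i <- enum 'I_r].

(* [(top; 1, ..., 1, bot, 1, ..., 1) . sigma] with [bot] in slot [l]. *)
Definition ct_of_it (k : fieldType) (C : wcooperad k) r (t : iterm C C r) :
    cterm C C r :=
  CTerm (it_r1 t) (it_top t)
    (fun i => if i == it_l t then it_r2 t else 1%N)
    (fun i => if i == it_l t as b return C (if b then it_r2 t else 1%N)
              then it_bot t else cone C)
    (it_dtop t) (fun i => if i == it_l t then it_dbot t else 0) (it_perm t).

(* For [s] of degree 1: [(-1)^|s mu1| (s mu1 o_l s mu2) . sigma]. *)
Definition it_susp (k : fieldType) (E C : smod k) (s : forall r, E r -> C r) r
    (t : iterm E E r) : iterm C C r :=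
  ITerm (it_r1 t) (it_r2 t) (sg k (it_dtop t + 1) *: s _ (it_top t)) (it_l t)
    (s _ (it_bot t)) (it_dtop t + 1) (it_dbot t + 1) (it_perm t).

(* For [q] of degree -1: the image of [t] under [q o_(1) q]. *)
Definition it_desusp (k : fieldType) (E C : smod k) (q : forall r, C r -> E r) r
    (t : iterm C C r) : iterm E E r :=
  ITerm (it_r1 t) (it_r2 t) (sg k (it_dtop t) *: q _ (it_top t)) (it_l t)
    (q _ (it_bot t)) (it_dtop t - 1) (it_dbot t - 1) (it_perm t).

(* Maps [D -> sE] concentrated in weight 1 whose extension to the cofree
   cooperad sends weight 2 to the corelations. *)
Definition is_corelated (k : fieldType) (P : quadratic_operad k) (D : wcooperad k)
    (q : forall r, D r -> qE P r) : Prop :=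
  [/\ is_smap (-1) q,
      forall w r (x : D r), wt w x -> w != 1%N -> q r x = 0 &
      forall r n (x : D r), deg n x -> wt 2 x -> exists y : qR P r,
        qincl y = \sum_(t <- cdelta1 x) it_eval (@qeta _ P) (it_desusp q t)].

(* [kd_coop] is the universal cooperad with cogenerators sE and corelations
   s^2 R.  Sign convention: [kd_s2 Gamma] is the element of weight 2 sent to
   [Gamma] by [s^-1 o_(1) s^-1], with the Koszul sign rule, so that
   [s mu1 o_l s mu2] is sent to [(-1)^|s mu1| mu1 o_l mu2].  The identification
   given by [s o_(1) s] is the opposite one: its decomposition has signs
   [(-1)^|mu1|] instead of [(-1)^|s mu1|], and for it the Massey products of
   [in_massey] contain the opposites of the values of Dimitrova's class. *)
Record koszul_dual (k : fieldType) (P : quadratic_operad k) := KoszulDual {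
  kd_coop :> wcooperad k;
  kd_s : forall r, qE P r -> kd_coop r;
  kd_s_smap : is_smap 1 kd_s;
  kd_s_wt : forall r (x : qE P r), wt 1 (kd_s x);
  kd_p : forall r, kd_coop r -> qE P r;
  kd_p_corel : is_corelated kd_p;
  kd_sK : forall r (x : qE P r), kd_p (kd_s x) = x;
  kd_pK : forall r (x : kd_coop r), wt 1 x -> kd_s (kd_p x) = x;
  kd_s2 : forall r, qR P r -> kd_coop r;
  kd_s2_smap : is_smap 2 kd_s2;
  kd_s2_wt : forall r (x : qR P r), wt 2 (kd_s2 x);
  kd_s2_inj : forall r (x y : qR P r), kd_s2 x = kd_s2 y -> x = y;
  kd_s2_surj : forall r (y : kd_coop r), wt 2 y -> exists x, kd_s2 x = y;
  kd_delta_s : forall r n (x : qE P r), deg n x ->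
    cteq (cdelta (kd_s x)) [:: ct_left (n + 1) (kd_s x); ct_right (n + 1) (kd_s x)];
  kd_delta1_s : forall r n (x : qE P r), deg n x ->
    iteq (cdelta1 (kd_s x)) (it_trivial (n + 1) (kd_s x));
  kd_delta_s2 : forall r n (Gamma : qR P r) ts, is_presentation n Gamma ts ->
    cteq (cdelta (kd_s2 Gamma))
      ([:: ct_left (n + 2) (kd_s2 Gamma); ct_right (n + 2) (kd_s2 Gamma)] ++
       [seq ct_of_it (it_susp kd_s t) | t <- ts]);
  kd_delta1_s2 : forall r n (Gamma : qR P r) ts, is_presentation n Gamma ts ->
    iteq (cdelta1 (kd_s2 Gamma))
      (it_trivial (n + 2) (kd_s2 Gamma) ++ [seq it_susp kd_s t | t <- ts]);
  kd_universal : forall (D : wcooperad k) (q : forall r, D r -> qE P r),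
    is_corelated q ->
    exists g : forall r, D r -> kd_coop r,
      [/\ cooperad_morphism g, forall r x, kd_p (g r x) = q r x &
          forall g' : forall r, D r -> kd_coop r, cooperad_morphism g' ->
            (forall r x, kd_p (g' r x) = q r x) -> forall r x, g' r x = g r x] }.

Definition kappa (k : fieldType) (P : quadratic_operad k) (C : koszul_dual P) r
    (mu : C r) : qO P r :=
  qgen (kd_p mu).

Record complex (k : fieldType) := Complex {
  cxcarrier :> gmod k;
  diff : cxcarrier -> cxcarrier;
  diff_lin : forall (a : k) x y, diff (a *: x + y) = a *: diff x + diff y;
  diff_deg : forall n x, deg n x -> deg (n - 1) (diff x);
  diff_diff : forall x, diff (diff x) = 0 }.

Lemma zero_diff_lin (k : fieldType) (H : gmod k) (a : k) (x y : H) :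
  0 = a *: 0 + 0 :> H.
Proof. by rewrite scaler0 addr0. Qed.

Definition zero_complex (k : fieldType) (H : gmod k) : complex k :=
  @Complex k H (fun _ => 0) (@zero_diff_lin k H)
    (fun n _ _ => deg_zero H (n - 1)) (fun _ => erefl).

(* [d(mu(x)) = sum_s (-1)^beta mu(x_1, ..., d(x_s), ..., x_r)] has right-hand side
   [diff_inputs n p f x] for [f = mu(-)] with [mu] of degree [n]. *)
Definition diff_inputs (k : fieldType) (A : complex k) (B : gmod k) r (n : int)
    (p : 'I_r -> int) (f : ('I_r -> A) -> B) (x : 'I_r -> A) : B :=
  \sum_(s < r) sg k (n + \sum_(t < r | (t < s)%N) p t) *:
    f (subst_at x s (diff (x s))).

Definition is_algebra (k : fieldType) (P : operad k) (A : gmod k)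
    (m : forall r, P r -> ('I_r -> A) -> A) : Prop :=
  [/\ is_cmap 0 m,
      forall x, m 1%N (ounit P) x = x ord0 &
      forall r1 r2 r (e : (r1 + r2)%N = r.+1) (a : P r1) (l : 'I_r1) (b : P r2)
        da db p x, deg da a -> deg db b -> homog p x ->
        m r (ocomp e a l b) x =
        infsum 0 m m [:: ITerm r1 r2 a l b da db 1%g] p x].

Definition is_dg_algebra (k : fieldType) (P : operad k) (A : complex k)
    (m : forall r, P r -> ('I_r -> A) -> A) : Prop :=
  is_algebra m /\
  forall r n (mu : P r) p x, deg n mu -> homog p x ->
    diff (m r mu x) = diff_inputs n p (m r mu) x.

(* [H] is the homology of [A]; only the values of [cl] on cycles matter. *)
Definition is_homology (k : fieldType) (A : complex k) (H : gmod k) (cl : A -> H) : Prop :=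
  [/\ forall (a : k) x y, diff x = 0 -> diff y = 0 ->
        cl (a *: x + y) = a *: cl x + cl y,
      forall x, diff x = 0 -> (cl x = 0 <-> exists y, x = diff y),
      forall h, exists2 x, diff x = 0 & cl x = h &
      forall n h, deg n h <-> exists x, [/\ deg n x, diff x = 0 & cl x = h]].

Definition is_induced (k : fieldType) (P : operad k) (A : complex k) (H : gmod k)
    (cl : A -> H) (mA : forall r, P r -> ('I_r -> A) -> A)
    (mH : forall r, P r -> ('I_r -> H) -> H) : Prop :=
  is_algebra mH /\
  forall r (mu : P r) y, (forall i, diff (y i) = 0) ->
    mH r mu (fun i => cl (y i)) = cl (mA r mu y).

(* Formal sums of terms over [C] and the operad [O] are elements of [C o O];
   they are evaluated on [O]-algebras.  [is_koszul_diff z w] means that [w]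
   represents the image of [z] under the differential of the Koszul complex,
   which applies the infinitesimal decomposition to the upper vertex, the
   twisting morphism to the resulting lower vertex, and composes the latter with
   the elements of [O] above it.  The universal choice is [B] the free [O]-algebra
   on [r] generators and [D = C o B]. *)
Definition is_koszul_diff (k : fieldType) (P : quadratic_operad k)
    (C : koszul_dual P) r (z w : seq (cterm C (qO P) r)) : Prop :=
  forall (B D : gmod k) (m : forall r, qO P r -> ('I_r -> B) -> B) psi e,
    is_algebra m -> @is_cmap k C B D e psi -> forall p x, homog p x ->
    fullsum psi m w p x =
    \sum_(t <- z) sg k (lambda t p) *:
      infsum (-1) psi (fun r mu => m r (kappa mu)) (cdelta1 (ct_top t))
        (ct_outdeg t p) (fun u => m _ (ct_bot t u) (ct_block t 0 x u)).

(* The homology of the Koszul complex is spanned by the class of [(1; 1)]. *)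
Definition is_koszul (k : fieldType) (P : quadratic_operad k) (C : koszul_dual P) : Prop :=
  (forall r (z : seq (cterm C (qO P) r)), r != 1%N ->
     List.Forall (@ct_ok _ _ _ _) z -> is_koszul_diff z [::] ->
     exists w, List.Forall (@ct_ok _ _ _ _) w /\ is_koszul_diff w z) /\
  (forall z : seq (cterm C (qO P) 1%N),
     List.Forall (@ct_ok _ _ _ _) z -> is_koszul_diff z [::] ->
     exists (c : k) w, List.Forall (@ct_ok _ _ _ _) w /\
       is_koszul_diff w
         (CTerm 1%N (c *: cone C) (fun _ => 1%N) (fun _ => ounit (qO P))
            0 (fun _ => 0) 1%g :: z)).

Definition is_oinf_algebra (k : fieldType) (C : wcooperad k) (A : complex k)
    (m : forall r, C r -> ('I_r -> A) -> A) : Prop :=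
  [/\ is_cmap (-1) m,
      forall x, m 1%N (cone C) x = 0 &
      forall r n (mu : C r) p x, deg n mu -> homog p x ->
        diff (m r mu x) + diff_inputs n p (m r mu) x +
        infsum (-1) m m (cdelta1 mu) p x = 0].

Definition is_inf_morphism (k : fieldType) (C : wcooperad k) (A B : complex k)
    (mA : forall r, C r -> ('I_r -> A) -> A)
    (mB : forall r, C r -> ('I_r -> B) -> B)
    (f : forall r, C r -> ('I_r -> A) -> B) : Prop :=
  is_cmap 0 f /\
  forall r n (mu : C r) p x, deg n mu -> homog p x ->
    infsum (-1) f mA (cdelta1 mu) p x - fullsum mB f (cdelta mu) p x =
    diff (f r mu x) - diff_inputs n p (f r mu) x.

Definition is_quasi_iso (k : fieldType) (A B : complex k) (g : A -> B) : Prop :=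
  (forall a, diff a = 0 -> (exists b, g a = diff b) -> exists a', a = diff a') /\
  (forall b, diff b = 0 -> exists a b', diff a = 0 /\ b = g a + diff b').

Definition linear_part (k : fieldType) (C : wcooperad k) (A B : gmod k)
    (f : forall r, C r -> ('I_r -> A) -> B) (a : A) : B :=
  f 1%N (cone C) (fun _ => a).

(* A differential graded algebra as a homotopy algebra. *)
Definition kappa_act (k : fieldType) (P : quadratic_operad k) (C : koszul_dual P)
    (A : gmod k) (m : forall r, qO P r -> ('I_r -> A) -> A) :
    forall r, C r -> ('I_r -> A) -> A :=
  fun r mu => m r (kappa mu).

Arguments kappa_act {k P} C {A} m r mu.

Record is_minimal_model (k : fieldType) (P : quadratic_operad k) (C : koszul_dual P)
    (A : complex k) (mA : forall r, qO P r -> ('I_r -> A) -> A)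
    (H : gmod k) (cl : A -> H) (mH : forall r, qO P r -> ('I_r -> H) -> H)
    (mm : forall r, C r -> ('I_r -> H) -> H)
    (f : forall r, C r -> ('I_r -> H) -> A) : Prop := {
  mm_oinf : @is_oinf_algebra k C (zero_complex H) mm;
  mm_extends : forall r (mu : qE P r) x, mm r (kd_s C mu) x = mH r (qgen mu) x;
  mm_morph : @is_inf_morphism k C (zero_complex H) A mm (kappa_act C mA) f;
  mm_qiso : @is_quasi_iso k (zero_complex H) A (linear_part f);
  mm_cycle : forall h, diff (linear_part f h) = 0;
  mm_rep : forall h, cl (linear_part f h) = h }.

(* [C^(w,t)(H, H)]; maps out of the weight [w] part are extended by zero. *)
Definition is_cochain (k : fieldType) (C : wcooperad k) (H : gmod k) (w : nat) (t : int)
    (g : forall r, C r -> ('I_r -> H) -> H) : Prop :=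
  is_cmap (- t - w%:Z) g /\
  forall w' r (mu : C r) x, wt w' mu -> w' != w -> g r mu x = 0.

(* [e] is the degree [w + t]; [gamma e] is gamma' up to parity. *)
Definition coboundary (k : fieldType) (P : quadratic_operad k) (C : koszul_dual P)
    (H : gmod k) (mH : forall r, qO P r -> ('I_r -> H) -> H) (e : int)
    (g : forall r, C r -> ('I_r -> H) -> H)
    r (mu : C r) (p : 'I_r -> int) (x : 'I_r -> H) : H :=
  infsum e (kappa_act C mH) g (cdelta1 mu) p x -
  sg k e *: infsum (-1) g (kappa_act C mH) (cdelta1 mu) p x.

Definition is_cocycle (k : fieldType) (P : quadratic_operad k) (C : koszul_dual P)
    (H : gmod k) (mH : forall r, qO P r -> ('I_r -> H) -> H) (w : nat) (t : int)
    (g : forall r, C r -> ('I_r -> H) -> H) : Prop :=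
  is_cochain w t g /\
  forall r n (mu : C r) p x, deg n mu -> wt w.+1 mu -> homog p x ->
    coboundary mH (w%:Z + t) g mu p x = 0.

Definition is_cohomologous (k : fieldType) (P : quadratic_operad k)
    (C : koszul_dual P) (H : gmod k) (mH : forall r, qO P r -> ('I_r -> H) -> H)
    (w : nat) (t : int) (g g' : forall r, C r -> ('I_r -> H) -> H) : Prop :=
  exists2 h : forall r, C r -> ('I_r -> H) -> H, is_cochain w t h &
  forall r n (mu : C r) p x, deg n mu -> wt w.+1 mu -> homog p x ->
    g r mu x - g' r mu x = coboundary mH (w%:Z + t) h mu p x.

Definition is_dimitrova_cocycle (k : fieldType) (P : quadratic_operad k)
    (C : koszul_dual P) (H : gmod k) (mm m : forall r, C r -> ('I_r -> H) -> H) : Prop :=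
  is_cochain 2 (-1) m /\
  forall r (Gamma : qR P r) x, m r (kd_s2 C Gamma) x = mm r (kd_s2 C Gamma) x.

(* [h] lies in the Massey product of the homogeneous classes [x], of degrees
   [p], defined by the expression [ts] of a relation: [y] and [rho] are the
   choices, and [z] gives an element of the indeterminacy. *)
Definition in_massey (k : fieldType) (P : quadratic_operad k)
    (A : complex k) (mA : forall r, qO P r -> ('I_r -> A) -> A)
    (H : gmod k) (cl : A -> H) (mH : forall r, qO P r -> ('I_r -> H) -> H)
    r (ts : seq (iterm (qE P) (qE P) r)) (p : 'I_r -> int) (x : 'I_r -> H)
    (h : H) : Prop :=
  let T i := tnth (in_tuple ts) i in
  let n i := it_dbot (T i) + \sum_(j < it_r2 (T i)) it_inner (T i) 0 p j + 1 in
  exists (y : 'I_r -> A) (rho : 'I_(size ts) -> A) (z : 'I_(size ts) -> H),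
    [/\ forall j, [/\ deg (p j) (y j), diff (y j) = 0 & cl (y j) = x j],
        forall i, deg (n i) (rho i) /\
          diff (rho i) = mA _ (qgen (it_bot (T i))) (it_inner (T i) 0 y),
        forall i, deg (n i) (z i) &
        h = cl (\sum_(i < size ts) sg k (gamma (-1) (T i) p) *:
                  mA _ (qgen (it_top (T i))) (it_outer (T i) 0 y (rho i))) +
            \sum_(i < size ts)
              mH _ (qgen (it_top (T i))) (it_outer (T i) 0 x (z i))].

(* Main.v *)
(* The chain map f(1) of the minimal model provides the representing cycles
   y_j = f(1)(x_j).  The morphism equation in weight 1 reads
   d(f(s mu)(x)) = f(1)(mu(x)) - mu(f(1)(x)), so that whenever
   mu2(x) = 0 one may take rho2 = - f(s mu2)(x).  In weight 2, since kappa
   vanishes on s^2 Gamma and the composites of operations on homology vanish by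
   assumption, the equation says that d(f(s^2 Gamma)(x)) is
   f(1)((s^2 Gamma)(x)) minus the Massey cycle built from these choices; hence
   m(s^2 Gamma; x) lies in the Massey product.  Finally a coboundary d(h)
   evaluated on s^2 Gamma reduces to the terms mu1(x, ..., h(s mu2; x), ..., x),
   which lie in the indeterminacy. *)
Require Import Defs.
From Stdlib Require List.
From Stdlib Require Import FunctionalExtensionality.
From mathcomp Require Import all_boot all_order all_fingroup all_algebra.
From mathcomp Require Import zify ring.

Set Implicit Arguments.
Unset Strict Implicit.
Unset Printing Implicit Defensive.

Import GRing.Theory.
Local Open Scope ring_scope.

(** * List positions and signs *)

Lemma Forall_tnth (T : Type) (Q : T -> Prop) (s : seq T) (i : 'I_(size s)) :
  List.Forall Q s -> Q (tnth (in_tuple s) i).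
Proof.
move=> hs; rewrite (tnth_nth (tnth (in_tuple s) i)) /=.
move: (tnth _ _) => d; case: i => i /=.
by elim: hs i => //= a l Qa _ IH [|i] //= lt_i; apply: IH.
Qed.

Lemma sgD (k : fieldType) (a b : int) : sg k (a + b) = sg k a * sg k b.
Proof. by rewrite /sg expfzDr // oppr_eq0 oner_eq0. Qed.

Lemma sg_double (k : fieldType) (a b : int) : sg k (a + 2 * b) = sg k a.
Proof. by rewrite sgD [in X in _ * X]/sg -exprz_exp -[(-1) ^ 2]/((-1) ^+ 2) sqrrN expr1n exp1rz mulr1. Qed.

(** Sign exponents agree only up to parity. Supplying half the difference, [c], turns a comparison
    of signs into an integer identity that [ring] decides. *)
Lemma sg_even (k : fieldType) (a b c : int) : a = b + 2 * c -> sg k a = sg k b.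
Proof. by move->; rewrite sg_double. Qed.

Lemma sg0 (k : fieldType) : sg k 0 = 1.
Proof. by []. Qed.

(** * Graded spaces, complexes and multilinear families *)

Section Graded.
Variables (k : fieldType) (A : gmod k).

Lemma deg_scale n (a : k) (x : A) : deg n x -> deg n (a *: x).
Proof.
by move=> hx; rewrite -[a *: x]addr0; apply: deg_lin => //; apply: deg_zero.
Qed.

Lemma deg_opp n (x : A) : deg n x -> deg n (- x).
Proof. by move=> hx; rewrite -scaleN1r; apply: deg_scale. Qed.

End Graded.

Lemma diff0 (k : fieldType) (A : complex k) : diff (0 : A) = 0.
Proof. by have := diff_lin (-1) (0 : A) 0; rewrite !scaleN1r !addNr. Qed.

Lemma diffN (k : fieldType) (A : complex k) (x : A) : diff (- x) = - diff x.
Proof.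
by have := diff_lin (-1) x 0; rewrite !scaleN1r diff0 !addr0.
Qed.

Section SmodMaps.
Variables (k : fieldType) (e : int) (M N : smod k) (f : forall r, M r -> N r).
Hypothesis hf : is_smap e f.

Lemma smap0 r : f (0 : M r) = 0.
Proof.
have [hl _ _] := hf; have := hl r 1 0 0.
by rewrite !scale1r addr0 => /eqP; rewrite -subr_eq0 opprD addNKr oppr_eq0 => /eqP.
Qed.

End SmodMaps.

Section Families.
Variables (k : fieldType) (M : smod k) (A B : gmod k) (e : int).
Variable f : forall r, M r -> ('I_r -> A) -> B.
Hypothesis hf : is_cmap e f.

Lemma cmap_op0 r x : f (0 : M r) x = 0.
Proof.
have := cmap_linl hf 1 (0 : M r) 0 x.
by rewrite !scale1r addr0 => /eqP; rewrite -subr_eq0 opprD addNKr oppr_eq0 => /eqP.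
Qed.

Lemma cmap_opZ r (a : k) (mu : M r) x : f (a *: mu) x = a *: f mu x.
Proof. by have := cmap_linl hf a mu 0 x; rewrite cmap_op0 !addr0. Qed.

Lemma subst_at_id (T : Type) r (x : 'I_r -> T) i : subst_at x i (x i) = x.
Proof.
by apply: functional_extensionality => j; rewrite /subst_at; case: eqP => [->|].
Qed.

Lemma cmap_input0 r (mu : M r) x i : x i = 0 -> f mu x = 0.
Proof.
move=> xi0; have := cmap_linr hf mu x i 1 0 0.
rewrite !scale1r addr0 -xi0 subst_at_id.
by move=> /eqP; rewrite -subr_eq0 opprD addNKr oppr_eq0 => /eqP.
Qed.

Lemma cmap_inputZ r (mu : M r) x i (a : k) v :
  f mu (subst_at x i (a *: v)) = a *: f mu (subst_at x i v).
Proof.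
have := cmap_linr hf mu x i a v 0; rewrite addr0 => ->.
by rewrite (cmap_input0 (x := subst_at x i 0) mu (i := i)) ?addr0 // /subst_at eqxx.
Qed.

End Families.

(** Every summand has a zero in one slot. In the morphism equation out of homology only the
    differential of the target therefore survives. *)
Lemma diff_inputs_zero (k : fieldType) (M : smod k) (H B : gmod k) e
    (f : forall r, M r -> ('I_r -> H) -> B) (hf : is_cmap e f) r n p (mu : M r) x :
  @diff_inputs k (zero_complex H) B r n p (f r mu) x = 0.
Proof.
rewrite /diff_inputs big1 // => s _.
by rewrite (cmap_input0 hf mu (i := s)) ?scaler0 // /subst_at eqxx.
Qed.

(** * Permuted inputs and the slots of a two-vertex composite *)

Section Plist.
Variables (T : Type) (d : T).

Lemma size_plist r (x : 'I_r -> T) s : size (plist x s) = r.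
Proof. by rewrite size_map size_enum_ord. Qed.

Lemma nth_plist r (x : 'I_r -> T) s i (lt_i : (i < r)%N) :
  nth d (plist x s) i = permuted x s (Ordinal lt_i).
Proof.
rewrite (nth_map (Ordinal lt_i)) ?size_enum_ord //.
by congr permuted; apply: val_inj; rewrite /= nth_enum_ord.
Qed.

Lemma nth_plist1 r (x : 'I_r -> T) (i : 'I_r) : nth d (plist x 1%g) i = x i.
Proof.
rewrite (nth_plist _ _ (ltn_ord i)) /permuted invg1 perm1.
by congr x; apply: val_inj.
Qed.

End Plist.

Lemma nth_plist_comp (T U : Type) (d : T) (d' : U) (g : T -> U) r (x : 'I_r -> T) s i :
  (i < r)%N -> nth d' (plist (g \o x) s) i = g (nth d (plist x s) i).
Proof. by move=> lt_i; rewrite !(nth_plist _ _ _ lt_i). Qed.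

Lemma alpha1 r (p : 'I_r -> int) : alpha 1%g p = 0.
Proof.
rewrite /alpha big1 // => i _; rewrite big_pred0 // => j.
by rewrite !perm1; case: ltngtP.
Qed.

Section Iterm.
Variables (k : fieldType) (M N : smod k) (r : nat) (t : iterm M N r).

Lemma it_inner_homog (A : gmod k) p (x : 'I_r -> A) :
  it_ok t -> homog p x -> homog (it_inner t 0 p) (it_inner t 0 x).
Proof.
move=> [_ _ ht] hx j; rewrite /it_inner.
have lt_j : (it_l t + j < r)%N.
  by have := ltn_ord (it_l t); have := ltn_ord j; lia.
by rewrite !(nth_plist _ _ _ lt_j); apply: hx.
Qed.

(** Trades the list surgery for a slotwise formula, which can be compared with blocks and
    substitutions. *)
Lemma it_outerE (T : Type) (d : T) x v (u : 'I_(it_r1 t)) : it_ok t ->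
  it_outer t d x v u = if u == it_l t then v
    else nth d (plist x (it_perm t)) (place (it_l t) (it_r2 t) u).
Proof.
move=> [_ _ ht]; rewrite /it_outer /place -val_eqE /=.
have lt_l := ltn_ord (it_l t); have lt_u := ltn_ord u.
have le_l : (it_l t <= r)%N by lia.
rewrite nth_cat size_takel ?size_plist //.
case: ltngtP => [lt_ul|lt_lu|->]; first by rewrite nth_take.
  (* Past the slot of the lower vertex, [v] itself occupies one place; this accounts for the [.-1]
     in [place]. *)
  have -> : (u - it_l t = (u - it_l t).-1.+1)%N by lia.
  by rewrite /= nth_drop; congr nth; lia.
by rewrite subnn.
Qed.

Lemma it_outer_slot (T : Type) (d : T) x v : it_ok t -> it_outer t d x v (it_l t) = v.
Proof. by move=> ht; rewrite it_outerE // eqxx. Qed.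

(** The filler [w] is arbitrary. This form makes linearity in a single input applicable to the lower
    value. *)
Lemma it_outer_subst (T : Type) (d : T) x v w : it_ok t ->
  it_outer t d x v = subst_at (it_outer t d x w) (it_l t) v.
Proof.
move=> ht; apply: functional_extensionality => u.
by rewrite /subst_at !it_outerE //; case: eqP.
Qed.

Lemma it_inner_comp (T U : Type) (d : T) (d' : U) (g : T -> U) (x : 'I_r -> T) :
  it_ok t -> it_inner t d' (g \o x) = g \o it_inner t d x.
Proof.
move=> [_ _ ht]; apply: functional_extensionality => j.
rewrite /it_inner /= (nth_plist_comp d) //.
by have := ltn_ord (it_l t); have := ltn_ord j; lia.
Qed.

End Iterm.

(** * Evaluation of the terms of a decomposition *)

Section Evaluation.
Variables (k : fieldType) (C : wcooperad k).

Lemma fullsum_cat (A B D : gmod k) (psi : forall r, C r -> ('I_r -> B) -> D)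
    (phi : forall r, C r -> ('I_r -> A) -> B) r (s t : seq (cterm C C r)) p x :
  fullsum psi phi (s ++ t) p x = fullsum psi phi s p x + fullsum psi phi t p x.
Proof. by rewrite /fullsum big_cat. Qed.

Lemma infsum_cat (A D : gmod k) e (psi : forall r, C r -> ('I_r -> A) -> D)
    (phi : forall r, C r -> ('I_r -> A) -> A) r (s t : seq (iterm C C r)) p x :
  infsum e psi phi (s ++ t) p x = infsum e psi phi s p x + infsum e psi phi t p x.
Proof. by rewrite /infsum big_cat. Qed.

(** Each [mu o_i 1] has the zero value of [phi] at [cone C] as an input. The term [1 o_1 mu] carries
    no sign: its upper vertex has degree 0 and no input precedes the lower one. *)
Lemma infsum_trivial (A D : gmod k) e e' (psi : forall r, C r -> ('I_r -> A) -> D)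
    (phi : forall r, C r -> ('I_r -> A) -> A) r n (mu : C r) p x :
  is_cmap e' psi -> (forall y, phi _ (cone C) y = 0) ->
  infsum e psi phi (it_trivial n mu) p x = psi _ (cone C) (fun _ => phi _ mu x).
Proof.
move=> hpsi phi1; rewrite /infsum /it_trivial big_cons big_map big1_seq => [|i _].
  rewrite addr0 /gamma /= alpha1 take0 big_nil mul0r mulr0 !addr0 sg0 scale1r.
  have -> : it_inner (ITerm 1 r (cone C) ord0 mu 0 n 1%g) 0 x = x.
    by apply: functional_extensionality => j; rewrite /it_inner /= add0n nth_plist1.
  congr psi; apply: functional_extensionality => u.
  by rewrite /it_outer /= take0 ord1.
rewrite /= phi1 (cmap_input0 hpsi mu (i := i)) ?scaler0 //.
rewrite /it_outer /= nth_cat size_takel ?size_plist ?ltnn ?subnn //.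
exact: ltnW.
Qed.

(** Here the upper vertex kills [(1; mu)]. The other term has no sign because its lower vertices
    have degree 0. *)
Lemma fullsum_trivial (A B D : gmod k) (psi : forall r, C r -> ('I_r -> B) -> D)
    (phi : forall r, C r -> ('I_r -> A) -> B) r n (mu : C r) p x :
  (forall y, psi _ (cone C) y = 0) ->
  fullsum psi phi [:: ct_left n mu; ct_right n mu] p x =
  psi _ mu (fun u => phi _ (cone C) (fun _ => x u)).
Proof.
move=> psi1; rewrite /fullsum !big_cons big_nil /= psi1 scaler0 add0r addr0.
rewrite /lambda /= alpha1 big1 ?add0r => [|u _]; last by rewrite mul0r.
rewrite sg0 scale1r; congr psi; apply: functional_extensionality => u.
congr phi; apply: functional_extensionality => j.
rewrite /ct_block /ct_offset /= ord1 addn0.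
rewrite (big_ord_narrow (ltnW (ltn_ord u)) (F := fun=> 1%N)) big_const_ord iter_addn_0 mul1n.
by rewrite nth_plist1.
Qed.

Lemma ct_offset_of_it r (t : iterm C C r) (u : 'I_(it_r1 t)) :
  ct_offset (ct_of_it t) u = if u == it_l t then it_l t : nat
    else place (it_l t) (it_r2 t) u.
Proof.
rewrite /ct_offset /= (big_ord_narrow (ltnW (ltn_ord u))
  (F := fun v => if v == it_l t then it_r2 t else 1%N)).
under eq_bigr do rewrite -val_eqE /=.
rewrite -(big_mkord xpredT (fun v => if v == it_l t :> nat then it_r2 t else 1%N)).
(* Only the block in slot [it_l t] may differ from size 1, so sums that pass it change by
   [it_r2 t - 1]. There [n] is positive, and the predecessor does not truncate. *)
have sumE n : (\sum_(0 <= v < n) (if v == it_l t :> nat then it_r2 t else 1)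
    = if n <= it_l t then n else (n + it_r2 t).-1)%N.
  elim: n => [|n IH]; first by rewrite big_nil.
  by rewrite big_nat_recr //= IH; case: (ltngtP n (it_l t)) => ?; lia.
by rewrite sumE /place -val_eqE /=; case: ltngtP.
Qed.

(** Units have degree 0, so only the lower vertex in slot [it_l t] moves past inputs with a sign. *)
Lemma lambda_of_it r (t : iterm C C r) p :
  lambda (ct_of_it t) p = alpha (it_perm t) p +
    it_dbot t * \sum_(d <- take (it_l t) (plist p (it_perm t))) d.
Proof.
rewrite /lambda /=; congr (_ + _).
rewrite (bigD1 (it_l t)) //= eqxx ct_offset_of_it eqxx [X in _ + X = _]big1 ?addr0 // => u.
by move=> /negPf ->; rewrite mul0r.
Qed.

(** All other blocks are single inputs, so the value has the shape of an infinitesimal composite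
    whose remaining inputs have passed through [phi] of [cone C], that is, f(1) for a morphism f. *)
Lemma fullsum_of_it (A B D : gmod k) (psi : forall r, C r -> ('I_r -> B) -> D)
    (phi : forall r, C r -> ('I_r -> A) -> B) r (t : iterm C C r) p x :
  it_ok t ->
  fullsum psi phi [:: ct_of_it t] p x =
  sg k (lambda (ct_of_it t) p) *: psi _ (it_top t)
    (it_outer t 0 (fun j => phi _ (cone C) (fun _ => x j))
       (phi _ (it_bot t) (it_inner t 0 x))).
Proof.
move=> ht; rewrite /fullsum big_cons big_nil addr0; congr (_ *: _).
congr psi; apply: functional_extensionality; rewrite /= => u.
rewrite it_outerE // /ct_block ct_offset_of_it /=.
have [_ _ hr] := ht; have lt_l := ltn_ord (it_l t); have lt_u := ltn_ord u.
(* The position is in range, so [nth] never returns its default 0. *)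
have lt_place : u != it_l t -> (place (it_l t) (it_r2 t) u < r)%N.
  by rewrite /place -val_eqE /=; case: (ltngtP u) => // ? _; lia.
move: lt_place; case: (u == it_l t) => // /(_ isT) lt_place.
rewrite (nth_plist _ _ _ lt_place) /permuted; congr phi.
apply: functional_extensionality => j.
by rewrite ord1 addn0 (nth_plist _ _ _ lt_place).
Qed.

End Evaluation.

(** * The twisting morphism and suspended composites *)

Section KoszulDual.
Variables (k : fieldType) (P : quadratic_operad k) (C : koszul_dual P).

Lemma qgen_smap : is_smap 0 (@qgen k P).
Proof.
have [[eta_lin eta_deg eta_act] _] := qF_free P.
have [[pr_lin pr_deg pr_act] _ _] := qproj_morph P.
split=> [r a x y|r n x hx|r x s]; rewrite /qgen.
- by rewrite eta_lin pr_lin.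
- by rewrite -[n + 0]addr0; apply: pr_deg; apply: eta_deg.
- by rewrite eta_act pr_act.
Qed.

Lemma kappa_smap : is_smap (-1) (@kappa k P C).
Proof.
have [g_lin g_deg g_act] := qgen_smap.
have [[p_lin p_deg p_act] _ _] := kd_p_corel C.
split=> [r a x y|r n x hx|r x s]; rewrite /kappa.
- by rewrite p_lin g_lin.
- by rewrite -[n + -1]addr0; apply: g_deg; apply: p_deg.
- by rewrite p_act g_act.
Qed.

Lemma kappa_wt w r (mu : C r) : wt w mu -> w != 1%N -> kappa mu = 0.
Proof.
move=> hw w1; have [_ p0 _] := kd_p_corel C.
by rewrite /kappa (p0 _ _ _ hw w1) (smap0 qgen_smap).
Qed.

Lemma kappa_s r (mu : qE P r) : kappa (kd_s C mu) = qgen mu.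
Proof. by rewrite /kappa kd_sK. Qed.

Lemma kappa_act_cmap (A : gmod k) (m : forall r, qO P r -> ('I_r -> A) -> A) :
  is_cmap 0 m -> is_cmap (-1) (kappa_act C m).
Proof.
have [l d a] := kappa_smap => hm; rewrite /kappa_act; split.
- by move=> r b mu nu x; rewrite l (cmap_linl hm).
- by move=> r mu x i b u v; rewrite (cmap_linr hm).
- move=> r n mu p x hmu hx; rewrite addrAC -[X in deg X]addr0.
  by apply: (cmap_deg hm) => //; apply: d.
- by move=> r mu s p x hx; rewrite a (cmap_act hm _ _ hx).
Qed.

Lemma kappa_act_wt (A : gmod k) (m : forall r, qO P r -> ('I_r -> A) -> A)
    (hm : is_cmap 0 m) w r (mu : C r) x :
  wt w mu -> w != 1%N -> kappa_act C m r mu x = 0.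
Proof. by move=> hw w1; rewrite /kappa_act (kappa_wt hw w1) (cmap_op0 hm). Qed.

Lemma it_susp_ok r (t : iterm (qE P) (qE P) r) : it_ok t -> it_ok (it_susp (kd_s C) t).
Proof.
have [_ s_deg _] := kd_s_smap C.
by move=> [h1 h2 h3]; split=> //=; [apply: deg_scale|]; apply: s_deg.
Qed.

Lemma infsum_susp (A D : gmod k) e e' (psi : forall r, C r -> ('I_r -> A) -> D)
    (phi : forall r, C r -> ('I_r -> A) -> A) r (ts : seq (iterm (qE P) (qE P) r)) p x :
  is_cmap e' psi ->
  infsum e psi phi [seq it_susp (kd_s C) t | t <- ts] p x =
  \sum_(t <- ts) sg k (gamma e (it_susp (kd_s C) t) p + (it_dtop t + 1)) *:
    psi _ (kd_s C (it_top t))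
      (it_outer t 0 x (phi _ (kd_s C (it_bot t)) (it_inner t 0 x))).
Proof.
move=> hpsi; rewrite /infsum big_map; apply: eq_bigr => t _.
by rewrite /= (cmap_opZ hpsi) scalerA -sgD.
Qed.

(** The zero sits in slot [it_l t] of the upper vertex. This is how the vanishing of the inner
    products on homology enters. *)
Lemma infsum_susp0 (A D : gmod k) e e' (psi : forall r, C r -> ('I_r -> A) -> D)
    (phi : forall r, C r -> ('I_r -> A) -> A) r (ts : seq (iterm (qE P) (qE P) r)) p x :
  is_cmap e' psi ->
  List.Forall (fun t => it_ok t /\ phi _ (kd_s C (it_bot t)) (it_inner t 0 x) = 0) ts ->
  infsum e psi phi [seq it_susp (kd_s C) t | t <- ts] p x = 0.
Proof.
move=> hpsi hts; rewrite (infsum_susp _ _ _ _ _ hpsi); elim: hts => [|t l [ht h0] _ IH].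
  by rewrite big_nil.
rewrite big_cons IH addr0 h0 (cmap_input0 hpsi _ (i := it_l t)) ?scaler0 //.
by rewrite it_outer_slot.
Qed.

(** The Massey sign emerges here: [lambda] and the suspension give [(|mu2| + 1) S + |mu1| + 1]
    besides [alpha], where S is the total degree of the inputs before the lower vertex. By parity
    this is [gamma] plus 1, hence the global minus sign. *)
Lemma fullsum_susp (A B D : gmod k) e' (psi : forall r, C r -> ('I_r -> B) -> D)
    (phi : forall r, C r -> ('I_r -> A) -> B) r (ts : seq (iterm (qE P) (qE P) r)) p x :
  is_cmap e' psi -> List.Forall (@it_ok _ _ _ _) ts ->
  fullsum psi phi [seq ct_of_it (it_susp (kd_s C) t) | t <- ts] p x =
  - (\sum_(t <- ts) sg k (gamma (-1) t p) *: psi _ (kd_s C (it_top t))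
      (it_outer t 0 (fun j => phi _ (cone C) (fun _ => x j))
         (phi _ (kd_s C (it_bot t)) (it_inner t 0 x)))).
Proof.
move=> hpsi; elim=> [|t l ht _ IH]; first by rewrite /fullsum !big_nil oppr0.
rewrite /= -cat1s fullsum_cat IH big_cons opprD; congr (_ + _).
rewrite fullsum_of_it; last exact: it_susp_ok.
rewrite lambda_of_it /= (cmap_opZ hpsi) scalerA -sgD -scaleNr; congr (_ *: _).
rewrite -mulN1r -[-1]/(sg k 1) -sgD /gamma.
(* The two exponents differ by [2 * (it_dtop t + S)]. *)
set S := \sum_(d <- _) d; apply: (@sg_even _ _ _ (it_dtop t + S)).
by ring.
Qed.

End KoszulDual.

(** * The morphism equation and coboundaries in low weight *)

Section MinimalModel.
Variables (k : fieldType) (P : quadratic_operad k) (C : koszul_dual P).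
Variables (A : complex k) (mA : forall r, qO P r -> ('I_r -> A) -> A).
Hypothesis hA : is_cmap 0 mA.
Variables (H : gmod k) (cl : A -> H) (mH : forall r, qO P r -> ('I_r -> H) -> H).
Variables (mm : forall r, C r -> ('I_r -> H) -> H).
Variables (f : forall r, C r -> ('I_r -> H) -> A).
Hypothesis hmm : is_minimal_model mA cl mH mm f.

Let f1 : H -> A := @linear_part k C H A f.

Lemma cmap_op_minimal : is_cmap (-1) mm.
Proof. by have [] := mm_oinf hmm. Qed.

Lemma minimal_cone x : mm (cone C) x = 0.
Proof. by have [_ ->] := mm_oinf hmm. Qed.

Lemma cmap_inf_minimal : is_cmap 0 f.
Proof. by have [] := mm_morph hmm. Qed.

(* [f(s mu)] is a homotopy between the operation [mu] on cycles and on classes. *)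
Lemma diff_inf_generator r n (mu : qE P r) p x : deg n mu -> homog p x ->
  diff (f (kd_s C mu) x) = f1 (mH (qgen mu) x) - mA (qgen mu) (f1 \o x).
Proof.
move=> hmu hx; have fC := cmap_inf_minimal.
have [_ s_deg _] := kd_s_smap C.
have [_ /(_ _ _ _ _ _ (s_deg _ _ _ hmu) hx)] := mm_morph hmm.
rewrite (diff_inputs_zero fC) subr0 => <-.
(* Decompositions are known only as classes, so they are replaced under evaluation on equivariant
   families. *)
rewrite (kd_delta1_s hmu cmap_op_minimal fC hx).
rewrite (infsum_trivial _ _ _ _ _ fC minimal_cone) (mm_extends hmm).
rewrite (kd_delta_s hmu fC (kappa_act_cmap C hA) hx).
rewrite fullsum_trivial; last first.
  by move=> y; apply: (kappa_act_wt hA y (cone_wt C)).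
by rewrite /kappa_act kappa_s.
Qed.

(** The minus sign of [fullsum_susp] cancels the one before the full decomposition in the morphism
    equation. The sum is thus added, and becomes the negative of a Massey cycle once [rho] is chosen
    as [- f(s mu2)]. *)
Lemma diff_inf_relation r n (Gamma : qR P r) ts p x :
  is_presentation n Gamma ts -> homog p x ->
  List.Forall (fun t => mH (qgen (it_bot t)) (it_inner t 0 x) = 0) ts ->
  diff (f (kd_s2 C Gamma) x) = f1 (mm (kd_s2 C Gamma) x) +
    \sum_(t <- ts) sg k (gamma (-1) t p) *: mA (qgen (it_top t))
      (it_outer t 0 (f1 \o x) (f (kd_s C (it_bot t)) (it_inner t 0 x))).
Proof.
move=> hG hx hts; have fC := cmap_inf_minimal; have [degG okG _] := hG.
have [_ s2_deg _] := kd_s2_smap C.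
have [_ /(_ _ _ _ _ _ (s2_deg _ _ _ degG) hx)] := mm_morph hmm.
rewrite (diff_inputs_zero fC) subr0 => <-.
rewrite (kd_delta1_s2 hG cmap_op_minimal fC hx) infsum_cat.
rewrite (infsum_trivial _ _ _ _ _ fC minimal_cone).
rewrite (infsum_susp0 _ _ fC); last first.
  elim: {hG} okG hts => [|t l [ht _] _ IH] hl; first by constructor.
  inversion_clear hl; constructor; last exact: IH.
  by rewrite (mm_extends hmm).
have kC := kappa_act_cmap C hA.
rewrite (kd_delta_s2 hG fC kC hx) fullsum_cat fullsum_trivial; last first.
  by move=> y; apply: (kappa_act_wt hA y (cone_wt C)).
rewrite (kappa_act_wt hA _ (kd_s2_wt C _)) // add0r addr0.
rewrite (fullsum_susp _ _ _ kC); last by elim: okG => [|t l [] *]; constructor.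
rewrite opprK; congr (_ + _); apply: eq_bigr => t _.
by rewrite /kappa_act kappa_s.
Qed.

End MinimalModel.

(** The exponent is 0 because [w + t = 1 - 1]. Each sign is moved into the slot of the lower vertex,
    so that every summand visibly lies in the indeterminacy. *)
Lemma coboundary_relation (k : fieldType) (P : quadratic_operad k) (C : koszul_dual P)
    (H : gmod k) (mH : forall r, qO P r -> ('I_r -> H) -> H) (hmH : is_cmap 0 mH)
    (h : forall r, C r -> ('I_r -> H) -> H) (hh : is_cochain 1 (-1) h)
    r n (Gamma : qR P r) ts p x :
  is_presentation n Gamma ts -> homog p x ->
  List.Forall (fun t => mH _ (qgen (it_bot t)) (it_inner t 0 x) = 0) ts ->
  coboundary mH 0 h (kd_s2 C Gamma) p x =
  \sum_(t <- ts) mH _ (qgen (it_top t)) (it_outer t 0 x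
    (sg k (gamma 0 (it_susp (kd_s C) t) p + (it_dtop t + 1)) *:
       h _ (kd_s C (it_bot t)) (it_inner t 0 x))).
Proof.
move=> hG hx hts; have [degG okG _] := hG; have [hC h_wt] := hh.
have kC := kappa_act_cmap C hmH.
rewrite /coboundary (kd_delta1_s2 hG hC kC hx) (kd_delta1_s2 hG kC hC hx) !infsum_cat.
have cone0 y : kappa_act C mH 1%N (cone C) y = 0 by apply: (kappa_act_wt hmH y (cone_wt C)).
(* In the second sum the units below die under [kappa], and the unit above dies because [h] lives in
   weight 1. *)
rewrite [X in _ - _ *: (X + _)](infsum_trivial _ _ _ _ _ hC cone0).
rewrite (h_wt 0%N) //; last exact: cone_wt.
rewrite (infsum_susp0 _ _ hC); last first.
  elim: {hG} okG hts => [|t l [ht _] _ IH] hl; first by constructor.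
  inversion_clear hl; constructor; last exact: IH.
  by rewrite /kappa_act kappa_s.
(* In the first sum the trivial terms apply [kappa] to an upper vertex of weight 0 or 2. *)
rewrite addr0 scaler0 subr0 {1}/infsum big_cons big_map cone0.
rewrite big1 => [|i _]; last by rewrite (kappa_act_wt hmH _ (kd_s2_wt C _)) // scaler0.
rewrite scaler0 !add0r (infsum_susp _ _ _ _ _ kC).
elim: {hG hts} okG => [|t l [ht _] _ IH]; first by rewrite !big_nil.
rewrite !big_cons IH; congr (_ + _).
rewrite [in RHS](it_outer_subst 0 x _ 0 ht) (cmap_inputZ hmH) -it_outer_subst //.
by rewrite {1}/kappa_act kappa_s.
Qed.

(** * Membership in the Massey coset *)

Theorem proposition4p1 (k : fieldType) (char0 : [pchar k] =i pred0)
    (P : quadratic_operad k) (Ered : reduced (qE P))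
    (C : koszul_dual P) (Pkoszul : is_koszul C)
    (A : complex k) (mA : forall r, qO P r -> ('I_r -> A) -> A)
    (hA : is_dg_algebra mA)
    (H : gmod k) (cl : A -> H) (hH : is_homology cl)
    (mH : forall r, qO P r -> ('I_r -> H) -> H) (hmH : is_induced cl mA mH)
    (mm : forall r, C r -> ('I_r -> H) -> H)
    (f : forall r, C r -> ('I_r -> H) -> A)
    (hmm : is_minimal_model mA cl mH mm f)
    (m : forall r, C r -> ('I_r -> H) -> H) (hm : is_dimitrova_cocycle mm m)
    (phi : forall r, C r -> ('I_r -> H) -> H)
    (phi_cocycle : is_cocycle mH 2 (-1) phi)
    (phi_class : is_cohomologous mH 1 (-1) phi m)
    (r : nat) (n : int) (Gamma : qR P r)
    (ts : seq (iterm (qE P) (qE P) r)) (hGamma : is_presentation n Gamma ts)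
    (p : 'I_r -> int) (x : 'I_r -> H) (hx : homog p x)
    (hvanish : List.Forall
      (fun t => mH _ (qgen (it_bot t)) (it_inner t 0 x) = 0) ts) :
  in_massey mA cl mH ts p x (phi r (kd_s2 C Gamma) x).
Proof.
have mA_cmap : is_cmap 0 mA by have [[]] := hA.
have mH_cmap : is_cmap 0 mH by have [[]] := hmH.
have [cl_lin cl_exact _ _] := hH.
have [h hh phi_m] := phi_class; have [degG okG _] := hGamma.
have [_ s_deg _] := kd_s_smap C; have [_ s2_deg _] := kd_s2_smap C.
have fC := cmap_inf_minimal hmm; have [hC _] := hh.
set f1 := @linear_part k C H A f.
have f1_deg d v : deg d v -> deg d (f1 v).
  move=> hv; have := @cmap_deg _ _ _ _ _ _ fC _ _ _ (fun _ => d) (fun _ => v)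
    (cone_deg C) (fun _ => hv).
  by rewrite big_ord1 add0r addr0.
have inner_f1 t : it_ok t -> it_inner t 0 (f1 \o x) = f1 \o it_inner t 0 x.
  by move=> ht; apply: it_inner_comp.
(* Choices are indexed by positions in [ts], so the hypotheses on summands are read off at
   positions. *)
have okT i := Forall_tnth i okG; have vanT i := Forall_tnth i hvanish.
exists (f1 \o x).
exists (fun i => let t := tnth (in_tuple ts) i in
  - f _ (kd_s C (it_bot t)) (it_inner t 0 x)).
(* These are the lower values, signs included, in [coboundary_relation]. *)
exists (fun i => let t := tnth (in_tuple ts) i in
  sg k (gamma 0 (it_susp (kd_s C) t) p + (it_dtop t + 1)) *:
    h _ (kd_s C (it_bot t)) (it_inner t 0 x)).
split.
- by move=> j; split; [apply: f1_deg | apply: (mm_cycle hmm) | apply: (mm_rep hmm)].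
- move=> i; set t := tnth _ i; have [ht _] := okT i; have [_ hb _] := ht.
  have hi := it_inner_homog ht hx; split.
    (* The suspension supplies the extra 1 in the required degree, and [f] has degree 0. *)
    apply: deg_opp; rewrite addrAC -[X in deg X]addr0.
    by apply: (cmap_deg fC) => //; apply: s_deg.
  rewrite diffN (diff_inf_generator mA_cmap hmm hb hi) vanT.
  have -> : linear_part f 0 = 0 by rewrite /linear_part (cmap_input0 fC _ (i := ord0)).
  by rewrite sub0r opprK inner_f1.
- move=> i; set t := tnth _ i; have [ht _] := okT i; have [_ hb _] := ht.
  have hi := it_inner_homog ht hx; apply: deg_scale.
  (* A cochain of bidegree (1, -1) has degree [-(-1) - 1 = 0], so the count is the same as for
     [rho]. *)
  rewrite addrAC -[X in deg X]addr0.
  by apply: (cmap_deg hC) => //; apply: s_deg.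
have := phi_m _ _ _ _ _ (s2_deg _ _ _ degG) (kd_s2_wt C Gamma) hx.
have [_ ->] := hm.
rewrite (coboundary_relation mH_cmap hh hGamma hx hvanish) => /eqP.
rewrite subr_eq addrC => /eqP ->.
have massey := diff_inf_relation mA_cmap hmm hGamma hx hvanish.
congr (_ + _); last by rewrite [LHS]big_tnth.
(* The Massey cycle is f(1) of the operation value minus a boundary. Both are cycles, as needed
   since [cl] is linear only on cycles. *)
set F := f _ _ _ in massey; rewrite (_ : \sum_(_ < _) _ = -1 *: diff F + f1 (mm _ (kd_s2 C Gamma) x)).
  rewrite cl_lin ?diff_diff // ?(mm_cycle hmm) // (mm_rep hmm).
  by have [_ ->] := cl_exact _ (diff_diff F); [rewrite scaler0 add0r | exists F].
(* The f(1) terms cancel; the remaining minus sign moves into the lower slot, where it is the sign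
   of [rho]. *)
rewrite massey scaleN1r opprD addrAC addNr add0r [in RHS]big_tnth -sumrN.
apply: eq_bigr => i _; have [ht _] := okT i; rewrite -scalerN; congr (_ *: _).
rewrite -scaleN1r (it_outer_subst 0 _ _ 0 ht) (cmap_inputZ mA_cmap).
by rewrite -it_outer_subst // scaleN1r.
Qed.
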